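(* Let $A:\Sigma^+\to\mathbb{R}$ be a Hölder continuous function. Then $A$ is cohomologous to a constant on the support of any maximizing measure by (the same) Hölder continuous coboundary function: there is a Hölder continuous function $V:\Sigma^+\to\mathbb{R}$ such that $A=V-V\circ\sigma+m_0$ on $\mathrm{supp}(\mu)$ for every maximizing measure $\mu$ for $A$. In particular, any $\sigma$-invariant Borel probability supported on the support of a maximizing measure for $A$ is maximizing for $A$.
   Context: $\Sigma^+$ is a one-sided topologically mixing subshift of finite type (the sequences $\mathbf{x}=(x_0,x_1,\ldots)$ over a finite alphabet all of whose consecutive pairs $(x_i,x_{i+1})$ are allowed by a 0-1 transition matrix), with shift map $\sigma:\Sigma^+\to\Sigma^+$. Fix $\lambda>1$ and endow $\Sigma^+$ with the metric $d(\mathbf{x},\mathbf{y})=\lambda^{-n}$, $n=\min\{k\ge 0: x_k\ne y_k\}$ (and $d(\mathbf{x},\mathbf{x})=0$). $m_0=\max\{\int A\,d\nu:\nu\ \sigma\text{-invariant Borel probability}\}$, and a maximizing measure for $A$ is a $\sigma$-invariant Borel probability $\mu$ with $\int A\,d\mu=m_0$. *)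

(* Defs.v *)
From HB Require Import structures.
From mathcomp Require Import all_boot all_order all_algebra.
From mathcomp Require Import all_classical all_reals all_analysis.
Set Implicit Arguments.
Unset Strict Implicit.
Unset Printing Implicit Defensive.
Import Order.TTheory GRing.Theory Num.Theory.
Import numFieldNormedType.Exports.
Local Open Scope classical_set_scope.
Local Open Scope ring_scope.

(* The 0-1 transition matrix is a boolean relation on the finite alphabet T. *)
Definition admissible (T : finType) (M : rel T) : set (nat -> T) :=
  [set x | forall i, M (x i) (x i.+1)].

(* The proofs hne and hlam are parameters of the type so that it can carry    *)
(* canonically the metric of parameter lam and, measurable types being        *)
(* pointed, its Borel sigma-algebra.                                          *)
Record sft (R : realType) (T : finType) (M : rel T) (lam : R)
    (hne : admissible M !=set0) (hlam : 1 < lam) : Type := Sft {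
  sft_seq :> nat -> T ;
  sft_adm : admissible M sft_seq }.

Section sft_structure.
Variables (R : realType) (T : finType) (M : rel T) (lam : R).
Variables (hne : admissible M !=set0) (hlam : 1 < lam).
Local Notation X := (sft hne hlam).

HB.instance Definition _ := gen_eqMixin X.
HB.instance Definition _ := gen_choiceMixin X.
HB.instance Definition _ := isPointed.Build X (Sft hne hlam (projT2 (cid hne))).

Lemma sft_ext (x y : X) : (forall k, x k = y k) -> x = y.
Proof.
case: x => x hx; case: y => y hy /= xy.
have {}xy : x = y by exact/funext.
by case: y / xy hy => hy; rewrite (Prop_irrelevance hx hy).
Qed.

Definition sft_dist (x y : X) : R :=
  if pselect (exists k, x k != y k) is left h then lam ^- (ex_minn h) else 0.

Let lam_gt0 : 0 < lam. Proof. exact: lt_trans hlam. Qed.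

Variant sft_dist_spec (x y : X) : R -> Prop :=
| SftDistEq of x = y : sft_dist_spec x y 0
| SftDistNe n of x n != y n & (forall k, (k < n)%N -> x k = y k) :
    sft_dist_spec x y (lam ^- n).

Lemma sft_distP (x y : X) : sft_dist_spec x y (sft_dist x y).
Proof.
rewrite /sft_dist; case: pselect => [h|h].
  case: ex_minnP => n xyn nmin; constructor => // k kn.
  by apply/eqP; apply: contraTT kn => /nmin; rewrite leqNgt.
constructor; apply: sft_ext => k; apply/eqP; apply/negPn/negP => xyk.
by apply: h; exists k.
Qed.

Lemma sft_distxx (x : X) : sft_dist x x = 0.
Proof. by case: sft_distP => // n; rewrite eqxx. Qed.

Lemma sft_dist_positivity (x y : X) : sft_dist x y = 0 -> x = y.
Proof.
case: sft_distP => // n _ _ /eqP.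
by rewrite invr_eq0 expf_eq0 (gt_eqF lam_gt0) andbF.
Qed.

Lemma sft_dist_sym (x y : X) : sft_dist x y = sft_dist y x.
Proof.
case: sft_distP => [->|n xyn xyk]; first by rewrite sft_distxx.
case: sft_distP => [yx|m xym yxk]; first by move: xyn; rewrite yx eqxx.
have [mn|nm|->//] := ltngtP m n.
- by move: xym; rewrite (xyk _ mn) eqxx.
- by move: xyn; rewrite (yxk _ nm) eqxx.
Qed.

Lemma sft_dist_triangle (y x z : X) :
  sft_dist x z <= sft_dist x y + sft_dist y z.
Proof.
have pos n : 0 <= lam ^- n by rewrite invr_ge0 exprn_ge0// ltW.
have dec (m n : nat) : (m <= n)%N -> lam ^- n <= lam ^- m.
  move=> mn; rewrite lef_pV2 ?posrE ?exprn_gt0//.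
  by rewrite ler_weXn2l// ltW.
case: (sft_distP x y) => [->|n xyn xyk]; first by rewrite add0r.
case: (sft_distP y z) => [<-|m yzm yzk].
  rewrite addr0; case: sft_distP => [_//|p xyp xypk].
  by apply: dec; rewrite leqNgt; apply/negP => /xyk/eqP; rewrite (negPf xyp).
case: sft_distP => [_|p xzp xzk]; first by rewrite addr_ge0.
have [np|pn] := leqP n p; first by rewrite (le_trans (dec _ _ np))// lerDl.
have [mp|pm] := leqP m p; first by rewrite (le_trans (dec _ _ mp))// lerDr.
by move: xzp; rewrite xyk// yzk// eqxx.
Qed.

HB.instance Definition _ := isMetric.Build R X
  sft_distxx sft_dist_positivity sft_dist_sym sft_dist_triangle.

(* Borel sigma-algebra of the metric topology *)
HB.instance Definition _ := Measurable.copy X (g_sigma_algebraType (@open X)).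

Definition sft_shift (x : X) : X :=
  Sft hne hlam (fun i => @sft_adm _ _ _ _ hne hlam x i.+1).

Definition topologically_mixing : Prop :=
  forall U V : set X, open U -> open V -> U !=set0 -> V !=set0 ->
  exists N, forall n, (N <= n)%N ->
    (U `&` iter n sft_shift @^-1` V) !=set0.

Definition holder (f : X -> R) : Prop :=
  exists alpha C : R, [/\ 0 < alpha, alpha <= 1 &
    forall x y, `|f x - f y| <= C * mdist x y `^ alpha].

Definition shift_invariant (nu : probability X R) : Prop :=
  forall B : set X, measurable B -> nu (sft_shift @^-1` B) = nu B.

Definition invariant_integrals (A : X -> R) : set R :=
  [set r | exists2 nu : probability X R,
    shift_invariant nu & r = \int[nu]_x A x].

(* m_0; the maximum is rendered as a supremum, which is total, and lemma      *)
(* max_integralE identifies it with the maximum.                              *)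
Definition max_integral (A : X -> R) : R := sup (invariant_integrals A).

Lemma max_integralE (A : X -> R) (m : R) :
  invariant_integrals A m -> ubound (invariant_integrals A) m ->
  max_integral A = m.
Proof.
move=> Am ubm; apply/eqP; rewrite eq_le; apply/andP; split.
- by apply: ge_sup => //; exists m.
- by apply: ub_le_sup => //; exists m.
Qed.

Definition maximizing (A : X -> R) (mu : probability X R) : Prop :=
  shift_invariant mu /\ \int[mu]_x A x = max_integral A.

Definition msupport (mu : probability X R) : set X :=
  [set x | forall U : set X, open U -> U x -> (0 < mu U)%E].

End sft_structure.

Arguments topologically_mixing {R T M lam} hne hlam.

(* Main.v *)
From HB Require Import structures.
Require Import Defs.
From mathcomp Require Import all_boot all_order all_algebra.
From mathcomp Require Import all_classical all_reals all_analysis.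
From mathcomp Require Import measurable_realfun.
From mathcomp Require Import ring lra.
Import Order.TTheory GRing.Theory Num.Theory.
Import numFieldNormedType.Exports.
Local Open Scope classical_set_scope.
Local Open Scope ring_scope.
Set Implicit Arguments.
Unset Strict Implicit.
Unset Printing Implicit Defensive.

(** Write [m0] for [max_integral A], [g] for [A - m0], and [S_n g] for the
    Birkhoff sums [birkhoff g n].  The whole theorem rests on a sub-action: a
    Hölder function [W >= 0] with [W x + g x <= W (sft_shift x)].  With
    [V := - W] the function [V - V \o sft_shift + m0 - A] is continuous and
    nonnegative, and by invariance its integral against a maximizing measure
    is [m0 - m0 = 0]; hence it vanishes on the support
    ([support_vanish]).  Integrating the resulting identity against an
    invariant measure carried by that support gives [m0] again, which is the
    second claim.

    The sub-action is [W y = sup {S_n g x | n, sft_shift^n x = y}].  Adding one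
    more step to an orbit segment gives the inequality
    ([subaction_shift]).  Finiteness ([birkhoff_mean_zero_le]) is where mixing
    enters, and the fact that [m0] bounds the integrals of all invariant
    measures: an orbit segment of
    length [n] is shadowed by a periodic orbit whose period exceeds [n] by a
    bounded number of symbols ([closing], [mixing_connect]); the sum of [g]
    along a full period is nonpositive, because the uniform measure on a
    periodic orbit competes in the supremum defining [m0]
    ([birkhoff_periodic_le]); and the two sums differ by a bounded amount
    because [A] varies geometrically on cylinders ([birkhoff_distortion]).
    Finally [W] is Hölder with the exponent of [A]: if [y] and [y'] share their
    first symbol, every preimage of [y] under an iterate of the shift turns
    into one of [y'] by changing its tail ([splice]), which costs at most the
    distortion ([subaction_geometric_variation]). *)

(** * Hölder functions in terms of cylinders *)

(** Since the distance of two points that first differ at index [n] is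
    [lam ^- n], its power [alpha] is the [n]-th power of this ratio. *)
Definition holder_ratio (R : realType) (lam alpha : R) : R := lam^-1 `^ alpha.

Section symbolic.
Context {R : realType} {T : finType} {M : rel T} {lam : R}.
Context {hne : admissible M !=set0} {hlam : 1 < lam}.
Local Notation X := (sft hne hlam).
Local Notation shift := (@sft_shift R T M lam hne hlam).
Implicit Types (x y p z : X) (f A V : X -> R) (m n k q : nat).

Definition agree n x y : Prop := forall k, (k < n)%N -> x k = y k.

Lemma agree_sym n x y : agree n x y -> agree n y x.
Proof. by move=> xy k /xy. Qed.

Lemma iter_shiftE n x i : iter n shift x i = x (i + n)%N.
Proof. by elim: n i => [|n IH] i; rewrite ?addn0//= IH addSnnS. Qed.

Lemma lam_gt0 : 0 < lam. Proof. exact: lt_trans hlam. Qed.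

Lemma holder_ratio_gt0 alpha : 0 < holder_ratio lam alpha.
Proof. by rewrite powR_gt0// invr_gt0 lam_gt0. Qed.

Lemma holder_ratio_lt1 alpha : 0 < alpha -> holder_ratio lam alpha < 1.
Proof.
move=> a0; have <- : (1 : R) `^ alpha = 1 by rewrite powR1.
apply: (gt0_ltr_powR a0); rewrite ?nnegrE//.
  by rewrite invr_ge0 ltW// lam_gt0.
by rewrite invf_lt1// lam_gt0.
Qed.

Lemma powR_holder_ratio alpha n :
  (lam ^- n) `^ alpha = holder_ratio lam alpha ^+ n.
Proof.
rewrite -exprVn -(@powR_mulrn _ lam^-1) ?invr_ge0 ?(ltW lam_gt0)//.
rewrite powRAC powR_mulrn//.
exact: powR_ge0.
Qed.

(** The form of the Hölder condition that the dynamics uses: the shift lowers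
    the number of common symbols by one, so each step backwards along an orbit
    gains a factor [theta]. *)
Definition geometric_variation (C theta : R) f : Prop :=
  forall n x y, agree n x y -> `|f x - f y| <= C * theta ^+ n.

Lemma holderP f : holder f <-> exists alpha C : R,
  [/\ 0 < alpha, alpha <= 1, 0 <= C
    & geometric_variation C (holder_ratio lam alpha) f].
Proof.
split=> -[alpha [C]].
  move=> [a0 a1 fC]; exists alpha, `|C|; split => // n x y xy.
  apply: (le_trans (fC x y)).
  apply: (@le_trans _ _ (`|C| * mdist x y `^ alpha)).
    by rewrite ler_wpM2r ?powR_ge0// ler_norm.
  rewrite ler_wpM2l//= /mdist/=.
  have th0 := ltW (holder_ratio_gt0 alpha).
  have th1 := ltW (holder_ratio_lt1 a0).
  case: sft_distP => [_|m xym _]; first by rewrite powR0 ?gt_eqF// exprn_ge0.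
  rewrite powR_holder_ratio ler_wiXn2l// leqNgt; apply/negP => /xy.
  by apply/eqP.
move=> [a0 a1 C0 fC]; exists alpha, C; split => // x y.
rewrite /mdist/=; case: sft_distP => [->|n xyn xy].
  by rewrite subrr normr0 mulr_ge0// powR_ge0.
by rewrite powR_holder_ratio; exact: fC.
Qed.

Lemma cylinder_nbhs n x : nbhs x (agree n x).
Proof.
have l0 := lam_gt0; apply/nbhs_ballP; exists (lam ^- n).
  by rewrite /= invr_gt0 exprn_gt0.
move=> y; rewrite ballEmdist/= /mdist/=; case: sft_distP => [->//|m _ xy].
rewrite ltf_pV2 ?posrE ?exprn_gt0// ltr_eXn2l// => nm k kn.
by apply: xy; exact: ltn_trans nm.
Qed.

Lemma open_symbol (a : T) : open [set x : X | x 0%N = a].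
Proof.
rewrite openE => x /= xa; apply: filterS (cylinder_nbhs 1 x) => y xy /=.
by rewrite -xy.
Qed.

Lemma nbhs_cylinder x (U : set X) : nbhs x U ->
  exists n, agree n x `<=` U.
Proof.
move=> /nbhs_ballP[e /= e0 xU]; have l0 := lam_gt0.
have : (1 * lam^-1 ^+ n) @[n --> \oo] --> (0 : R).
  by apply: cvg_geometric; rewrite ger0_norm ?invf_lt1// invr_ge0 ltW.
move=> /cvgrPdist_lt /(_ _ e0) [n _ /(_ n (leqnn n))/=].
rewrite sub0r normrN mul1r exprVn => ne; exists n => y xy; apply: xU.
rewrite ballEmdist/= /mdist/=; case: sft_distP => [//|m xym _].
apply: le_lt_trans (le_lt_trans (ler_norm _) ne).
rewrite lef_pV2 ?posrE ?exprn_gt0// ler_eXn2l// leqNgt.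
by apply/negP => /xy; apply/eqP.
Qed.

Lemma shift_continuous : continuous shift.
Proof.
move=> x U /nbhs_cylinder[n nU].
apply: (@filterS X (nbhs x) (nbhs_filter x) _ _ _ (cylinder_nbhs n.+1 x)).
move=> y xy.
by apply: nU => k kn; exact: xy.
Qed.

Lemma geometric_variation_continuous C theta f : 0 < theta -> theta < 1 ->
  geometric_variation C theta f -> continuous f.
Proof.
move=> th0 th1 fC x U /nbhs_ballP[e /= e0 eU].
have : C * theta ^+ n @[n --> \oo] --> (0 : R).
  by apply: cvg_geometric; rewrite ger0_norm// ltW.
move=> /cvgrPdist_lt /(_ _ e0) [n _ /(_ n (leqnn n))/=].
rewrite sub0r normrN => Cn.
apply: (@filterS X (nbhs x) (nbhs_filter x) _ _ _ (cylinder_nbhs n x)) => y xy.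
apply: eU; rewrite -ball_normE/=.
by apply: le_lt_trans (fC _ _ _ xy) _; exact: le_lt_trans (ler_norm _) Cn.
Qed.

Lemma geometric_variation_bounded C theta f : geometric_variation C theta f ->
  exists K, forall x, `|f x| <= K.
Proof.
move=> fC; exists (`|f point| + C) => x.
rewrite -[f x](subrK (f point)) addrC; apply: le_trans (ler_normD _ _) _.
by rewrite lerD2l; have := fC 0%N x point; rewrite expr0 mulr1; apply.
Qed.

Lemma geometric_variation_subr C theta f (c : R) :
  geometric_variation C theta f ->
  geometric_variation C theta (fun x => f x - c).
Proof.
by move=> fC n x y /fC; rewrite opprD opprK addrACA [- c + _]addrC subrr addr0.
Qed.

(** * Birkhoff sums and periodic orbits *)

Definition birkhoff f n x : R := \sum_(i < n) f (iter i shift x).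

Lemma birkhoffSl f n x : birkhoff f n.+1 x = f x + birkhoff f n (shift x).
Proof.
rewrite /birkhoff big_ord_recl/=; congr (_ + _).
by under [RHS]eq_bigr do rewrite -iterSr.
Qed.

Lemma birkhoffSr f n x :
  birkhoff f n.+1 x = birkhoff f n x + f (iter n shift x).
Proof. by rewrite /birkhoff big_ord_recr. Qed.

Lemma birkhoffD f m n x :
  birkhoff f (m + n) x = birkhoff f m x + birkhoff f n (iter m shift x).
Proof.
rewrite /birkhoff big_split_ord/=; congr (_ + _).
by apply: eq_bigr => i _; rewrite addnC iterD.
Qed.

(** The terms of the two sums differ by at most [C * theta ^+ (m + j)] with
    [j] running over [1..n], so the total is bounded independently of [n]. *)
Lemma birkhoff_distortion C theta f m n x y :
    0 <= C -> 0 < theta -> theta < 1 -> geometric_variation C theta f ->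
    agree (n + m) x y ->
  `|birkhoff f n x - birkhoff f n y| <= C / (1 - theta) * theta ^+ m.
Proof.
move=> C0 th0 th1 fC xy.
have d0 : 0 < 1 - theta by lra.
(* The factor [1 - theta ^+ n], proportional to a partial geometric sum, *)
(* makes the induction on [n] go through.                                *)
suff : `|birkhoff f n x - birkhoff f n y|
    <= C / (1 - theta) * theta ^+ m * (1 - theta ^+ n).
  move=> /le_trans; apply; rewrite ler_piMr//.
    by rewrite mulr_ge0 ?divr_ge0 ?exprn_ge0// ltW.
  by rewrite lerBlDr lerDl exprn_ge0// ltW.
elim: n x y xy => [|n IH] x y xy.
  by rewrite /birkhoff !big_ord0 !subrr mulr0 normr0.
rewrite !birkhoffSl opprD addrACA (le_trans (ler_normD _ _))//.
have sxy : agree (n + m) (shift x) (shift y) by move=> k kn; apply: xy.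
apply: (le_trans (lerD (fC _ _ _ xy) (IH _ _ sxy))).
have d1 : 1 - theta != 0 by rewrite gt_eqF.
rewrite -subr_ge0 addSn !exprS exprD.
have -> : forall a b : R, C / (1 - theta) * b * (1 - theta * a) -
  (C * (theta * (a * b)) + C / (1 - theta) * b * (1 - a)) =
  C * a * b * (1 - theta) by move=> a b; field.
by rewrite !mulr_ge0 ?exprn_ge0// ltW.
Qed.

(** The shift space is Markov: the first [n] symbols of [x] may be followed by
    any point whose first symbol is that of [iter n shift x]. *)
Lemma splice n m x y y' : iter n shift x = y -> agree m.+1 y y' ->
  exists2 x', iter n shift x' = y' & agree (n + m.+1) x x'.
Proof.
move=> xy yy'.
pose s i := if (i < n)%N then x i else y' (i - n)%N.
have sadm : admissible M s.
  move=> i; rewrite /s; have [i1n|] := ltnP i.+1 n.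
    by rewrite (ltnW i1n); exact: (sft_adm x).
  rewrite leq_eqVlt => /predU1P[ni|ni]; last first.
    by rewrite ltnNge -ltnS ni/= subSn -1?ltnS//; exact: (sft_adm y').
  rewrite ni ltnSn subnn -yy'// -xy iter_shiftE add0n ni; exact: (sft_adm x).
exists (Sft hne hlam sadm).
  by apply: sft_ext => k; rewrite iter_shiftE/= /s ltnNge leq_addl/= addnK.
move=> k kn /=; rewrite /s; case: ltnP => // nk.
by rewrite -yy' -?xy ?iter_shiftE ?subnK// ltn_subLR.
Qed.

(** The periodic point repeats the word made of the first [n] symbols of [x]
    followed by the first [k] symbols of [z], which lead back to [x 0]. *)
Lemma closing n k x z : (0 < n)%N -> z 0%N = x n -> z k = x 0%N ->
  exists2 p, iter (n + k) shift p = p & agree n x p.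
Proof.
move=> n0 zx zk; set q := (n + k)%N.
have q0 : (0 < q)%N by rewrite addn_gt0 n0.
pose w r := if (r < n)%N then x r else z (r - n)%N.
have wS r : (r < q)%N -> M (w r) (w r.+1).
  move=> rq; rewrite /w; have [r1n|] := ltnP r.+1 n.
    by rewrite (ltnW r1n); exact: (sft_adm x).
  rewrite leq_eqVlt => /predU1P[nr|nr]; last first.
    by rewrite ltnNge -ltnS nr/= subSn -1?ltnS//; exact: (sft_adm z).
  rewrite nr ltnSn subnn zx nr; exact: (sft_adm x).
have wq : w q = w 0%N by rewrite /w n0 ltnNge leq_addr/= addKn.
pose s i := w (i %% q)%N.
have sadm : admissible M s.
  move=> i; have := wS _ (ltn_pmod i q0).
  rewrite /s -[i.+1]addn1 -modnDml addn1.
  have := ltn_pmod i q0; rewrite leq_eqVlt => /predU1P[->|iq].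
    by rewrite modnn wq.
  by rewrite [(_.+1 %% _)%N]modn_small.
exists (Sft hne hlam sadm).
  by apply: sft_ext => i; rewrite iter_shiftE/= /s modnDr.
move=> i i_n /=; rewrite /s modn_small; last first.
  by rewrite (leq_trans i_n)// leq_addr.
by rewrite /w i_n.
Qed.

(** Only finitely many pairs of symbols have to be joined, hence the uniform
    bound on the length of the connecting words. *)
Lemma mixing_connect : topologically_mixing hne hlam ->
  exists K, forall x y, exists z k,
    [/\ (k <= K)%N, z 0%N = x 0%N & z k = y 0%N].
Proof.
move=> mix.
pose joins (ab : T * T) k := exists2 z : X, z 0%N = ab.1 & z k = ab.2.
have /choice[kf kfP] : forall ab : T * T, exists k,
    (exists k', joins ab k') -> joins ab k.
  move=> ab.
  by have [[k abk]|nk] := pselect (exists k, joins ab k); [exists k|exists 0%N].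
exists (\max_ab kf ab) => x y.
have [||||N NP] := mix [set z : X | z 0%N = x 0%N] [set z : X | z 0%N = y 0%N].
- exact: open_symbol.
- exact: open_symbol.
- by exists x.
- by exists y.
have [z0 [/= z0x z0y]] := NP N (leqnn N).
have [|z zx zy] := kfP (x 0%N, y 0%N).
  by exists N, z0 => //=; move: z0y; rewrite iter_shiftE.
by exists z, (kf (x 0%N, y 0%N)); split => //; exact: leq_bigmax.
Qed.

End symbolic.

(** * Integration against invariant measures *)

Section measures.
Context {R : realType} {T : finType} {M : rel T} {lam : R}.
Context {hne : admissible M !=set0} {hlam : 1 < lam}.
Local Notation X := (sft hne hlam).
Local Notation shift := (@sft_shift R T M lam hne hlam).
Implicit Types (x y p z : X) (f A V : X -> R) (m n k q : nat).
Implicit Types (mu nu : probability X R).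

Lemma open_measurable_sft (U : set X) : open U -> measurable U.
Proof. exact: sub_sigma_algebra. Qed.

Lemma continuous_measurable_sft f : continuous f -> measurable_fun setT f.
Proof.
move=> /continuousP cf.
apply: (measurability _ (RGenOpens.measurableE R)).
move=> _ [_ [a [b ->] <-]]; rewrite setTI; apply: open_measurable_sft.
exact/cf/interval_open.
Qed.

Lemma shift_measurable : measurable_fun setT shift.
Proof.
apply: (@measurability _ _ _ _ _ _ (@open X)) => //.
move=> _ [U oU <-]; rewrite setTI; apply: open_measurable_sft.
by have /continuousP := @shift_continuous R T M lam hne hlam; apply.
Qed.

Lemma bounded_integrable nu f : continuous f ->
  (exists K : R, forall x, `|f x| <= K) -> nu.-integrable setT (EFin \o f).
Proof.
move=> cf [K fK]; apply: measurable_bounded_integrable => //.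
- by rewrite -ge0_fin_numE ?fin_num_measure.
- exact: continuous_measurable_sft.
- exists K; split; first exact: num_real.
  by move=> r Kr x _ /=; rewrite (le_trans (fK x))// ltW.
Qed.

Lemma continuous_comp_shift f : continuous f -> continuous (f \o shift).
Proof.
by move=> cf x; apply: continuous_comp; [exact: shift_continuous|exact: cf].
Qed.

Lemma Rintegral_shift nu f : shift_invariant nu -> continuous f ->
    (exists K : R, forall x, `|f x| <= K) ->
  \int[nu]_x f (shift x) = \int[nu]_x f x.
Proof.
move=> inv cf fK; rewrite /Rintegral; congr fine.
have mf : measurable_fun setT (EFin \o f).
  by apply/measurable_EFinP; exact: continuous_measurable_sft.
have intf : nu.-integrable (shift @^-1` setT) ((EFin \o f) \o shift).
  rewrite preimage_setT; apply: (@bounded_integrable nu (f \o shift)).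
    exact: continuous_comp_shift.
  by case: fK => K fK; exists K => x; exact: fK.
have := integral_pushforward shift_measurable mf intf measurableT.
rewrite preimage_setT => <-.
apply: eq_measure_integral; first exact: shift_measurable.
by move=> mshift B mB _; exact: inv.
Qed.

Lemma Rintegral_prob_cst nu (c : R) : \int[nu]_x c = c.
Proof.
rewrite Rintegral_cst//; transitivity (c * fine 1%E); last by rewrite mulr1.
by congr (_ * fine _); exact: probability_setT.
Qed.

Lemma Rintegral_coboundary nu V (c : R) : shift_invariant nu ->
    continuous V -> (exists K : R, forall x, `|V x| <= K) ->
  \int[nu]_x (V x - V (shift x) + c) = c.
Proof.
move=> inv cV VK.
have iV := bounded_integrable nu cV VK.
have iVs : nu.-integrable setT (EFin \o (V \o shift)).
  apply: bounded_integrable; first exact: continuous_comp_shift.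
  by case: VK => K VK; exists K => x; exact: VK.
rewrite RintegralD//; last exact: finite_measure_integrable_cst.
  by rewrite RintegralB// Rintegral_shift// subrr add0r Rintegral_prob_cst.
exact: (integrableB measurableT iV iVs).
Qed.

Section orbit_measure.
Variables (q : nat) (p : X).

(** The uniform measure on an orbit segment of length [q.+1], which is invariant
    when the segment closes up.  Indexing by the predecessor of the length makes
    it a probability measure without side condition. *)
Definition orbit_measure : set X -> \bar R :=
  mscale (q.+1%:R^-1)%:nng (msum (fun i => \d_(iter i shift p)) q.+1).

HB.instance Definition _ := Measure.on orbit_measure.

Lemma orbit_measure_setT : orbit_measure setT = 1%E.
Proof.
rewrite /orbit_measure /mscale/= /msum.
rewrite (eq_bigr (fun=> 1%:E)); last by move=> i _; exact: diracT.
by rewrite sumEFin sumr_const card_ord -EFinM mulVf// pnatr_eq0.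
Qed.

HB.instance Definition _ :=
  Measure_isProbability.Build _ _ _ orbit_measure orbit_measure_setT.

Lemma orbit_measure_invariant : iter q.+1 shift p = p ->
  shift_invariant orbit_measure.
Proof.
move=> pq B mB; rewrite /orbit_measure /mscale/= /msum; congr (_ * _)%E.
transitivity (\sum_(i < q.+1) \d_(iter i.+1 shift p) B : \bar R)%E; first by [].
rewrite [LHS]big_ord_recr [RHS]big_ord_recl/= addeC.
by move: pq => /= ->.
Qed.

Lemma Rintegral_orbit f : continuous f ->
    (exists K : R, forall x, `|f x| <= K) ->
  \int[orbit_measure]_x f x = birkhoff f q.+1 p / q.+1%:R.
Proof.
move=> cf [K fK].
have q0 : q.+1%:R != 0 :> R by rewrite pnatr_eq0.
have iint := bounded_integrable orbit_measure cf (ex_intro _ K fK).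
(* Adding the bound [K] reduces to nonnegative integrands. *)
suff : \int[orbit_measure]_x (f x + K) = birkhoff f q.+1 p / q.+1%:R + K.
  rewrite RintegralD//; last exact: finite_measure_integrable_cst.
  rewrite Rintegral_prob_cst; exact: addIr.
have fK0 x : 0 <= f x + K.
  by have := fK x; rewrite ler_norml => /andP[+ _]; rewrite -subr_ge0 opprK.
have mfK : measurable_fun setT (fun x => (f x + K)%:E).
  apply/measurable_EFinP/measurable_funD; last exact: measurable_cst.
  exact: continuous_measurable_sft.
have fK0' (x : X) : setT x -> (0 <= (f x + K)%:E)%E by rewrite lee_fin.
rewrite /Rintegral /orbit_measure ge0_integral_mscale//.
rewrite ge0_integral_measure_sum//.
rewrite (eq_bigr (fun i : 'I_q.+1 => (f (iter i shift p) + K)%:E)); last first.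
  by move=> i _; rewrite integral_dirac// diracE in_setT mul1e.
rewrite sumEFin -EFinM/= big_split/= sumr_const card_ord.
by rewrite -/(birkhoff f q.+1 p) -mulr_natl; field.
Qed.

End orbit_measure.

Lemma invariant_integrals_ubound f : continuous f ->
  (exists K : R, forall x, `|f x| <= K) -> has_ubound (invariant_integrals f).
Proof.
move=> cf [K fK]; exists K => _ [nu _ ->].
have iint := bounded_integrable nu cf (ex_intro _ K fK).
apply: le_trans (_ : \int[nu]_x K <= _).
  apply: le_Rintegral => //; first exact: finite_measure_integrable_cst.
  by move=> x _; rewrite (le_trans (ler_norm _)).
by rewrite Rintegral_prob_cst.
Qed.

Lemma birkhoff_periodic_le f q p : continuous f ->
    (exists K : R, forall x, `|f x| <= K) -> iter q shift p = p ->
  birkhoff f q p <= max_integral f * q%:R.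
Proof.
move=> cf fK; case: q => [|q] pq; first by rewrite /birkhoff big_ord0 mulr0.
rewrite -ler_pdivrMr ?ltr0n// -(Rintegral_orbit q p cf fK).
apply: ub_le_sup; first exact: invariant_integrals_ubound.
by exists (orbit_measure q p) => //; exact: orbit_measure_invariant.
Qed.

(** The open set where [f] is positive is null, so it misses the support. *)
Lemma support_vanish mu f : continuous f -> (forall x, 0 <= f x) ->
    (exists K : R, forall x, `|f x| <= K) -> \int[mu]_x f x = 0 ->
  forall x, msupport mu x -> f x = 0.
Proof.
move=> cf f0 fK int0 x xsupp; apply/eqP/negPn/negP => fx0.
have iint := bounded_integrable mu cf fK.
have oU : open [set y | 0 < f y].
  have /continuousP := cf; exact: (fun h => h _ (@open_gt R 0)).
have : mu.-negligible [set y | 0 < f y].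
  have : ae_eq mu setT (EFin \o f) (cst 0%E).
    apply/ae_eq_integral_abs => //.
      by apply/measurable_EFinP; exact: continuous_measurable_sft.
    under eq_integral do rewrite /= ger0_norm//.
    by rewrite -[LHS]fineK ?integrable_fin_num//; congr EFin.
  apply: negligibleS => y /= fy; apply/not_implyP; split => // -[].
  by move=> fy0; rewrite fy0 ltxx in fy.
move=> /(negligibleP _ (open_measurable_sft oU)) muU.
suff : (0 < mu [set y | (0 < f y)%R])%E by rewrite muU ltxx.
by apply: xsupp => //=; rewrite lt_def fx0 f0.
Qed.

Lemma msupport_measurable mu : measurable (msupport mu).
Proof.
rewrite -[msupport mu]setCK; apply: measurableC; apply: open_measurable_sft.
rewrite openE => x /= /existsNP[U /not_implyP[oU /not_implyP[Ux muU]]].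
apply: filterS (open_nbhs_nbhs (conj oU Ux)) => y Uy /(_ U oU Uy); exact: muU.
Qed.

Lemma Rintegral_support mu nu f g : continuous f -> continuous g ->
    nu (msupport mu) = 1%E -> (forall x, msupport mu x -> f x = g x) ->
  \int[nu]_x f x = \int[nu]_x g x.
Proof.
move=> cf cg nu1 fg; rewrite /Rintegral; congr fine.
apply: ae_eq_integral => //.
- by apply/measurable_EFinP; exact: continuous_measurable_sft.
- by apply/measurable_EFinP; exact: continuous_measurable_sft.
exists (~` msupport mu); split.
- by apply: measurableC; exact: msupport_measurable.
- transitivity (1 - nu (msupport mu))%E; last by rewrite nu1 subee.
  by apply: probability_setC; exact: msupport_measurable.
- by move=> x /= nfg xs; apply: nfg => _; rewrite fg.
Qed.

End measures.

(** * The sub-action *)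

Section subaction.
Context {R : realType} {T : finType} {M : rel T} {lam : R}.
Context {hne : admissible M !=set0} {hlam : 1 < lam}.
Local Notation X := (sft hne hlam).
Local Notation shift := (@sft_shift R T M lam hne hlam).
Implicit Types (x y p z : X) (f A V : X -> R) (m n k q : nat).

Lemma birkhoff_subr f c n x :
  birkhoff (fun u => f u - c) n x = birkhoff f n x - c * n%:R.
Proof. by rewrite /birkhoff sumrB sumr_const card_ord mulr_natr. Qed.

(** Closing the orbit segment costs the distortion [C / (1 - theta)] on the part
    that is shadowed, and at most [K] connecting steps on which [f] minus
    its maximal integral is bounded below. *)
Lemma birkhoff_mean_zero_le C theta f : topologically_mixing hne hlam ->
    0 <= C -> 0 < theta -> theta < 1 -> geometric_variation C theta f ->
  exists2 D : R, 0 <= D &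
    forall n x, birkhoff (fun u => f u - max_integral f) n x <= D.
Proof.
move=> mix C0 th0 th1 fC.
have cf := geometric_variation_continuous th0 th1 fC.
have [L fL] := geometric_variation_bounded fC.
have [K KP] := mixing_connect mix.
set m0 := max_integral f; pose g x := f x - m0.
have gC : geometric_variation C theta g.
  exact: geometric_variation_subr.
pose L' := L + `|m0|.
have gL x : - L' <= g x.
  have := fL x; rewrite ler_norml => /andP[+ _]; have := ler_norm m0.
  rewrite /g /L'; lra.
have L0 : 0 <= L' by rewrite addr_ge0// (le_trans _ (fL point)).
have d0 : 0 < 1 - theta by lra.
have D0 : 0 <= C / (1 - theta) by rewrite divr_ge0// ltW.
exists (C / (1 - theta) + L' * K%:R); first by rewrite addr_ge0// mulr_ge0.
move=> [|n] x; first by rewrite /birkhoff big_ord0 addr_ge0// mulr_ge0.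
have [z [k [kK zx zk]]] := KP (iter n.+1 shift x) x.
rewrite iter_shiftE add0n in zx.
have [p pp xp] := closing (ltn0Sn n) zx zk.
have : birkhoff g (n.+1 + k) p <= 0.
  by rewrite birkhoff_subr subr_le0 birkhoff_periodic_le//; exists L.
rewrite birkhoffD.
have tail : - (L' * K%:R) <= birkhoff g k (iter n.+1 shift p).
  apply: (@le_trans _ _ (- (L' * k%:R))).
    by rewrite lerN2 ler_wpM2l// ler_nat.
  rewrite -mulNr mulr_natr -[in leLHS](card_ord k) -sumr_const.
  by apply: ler_sum => i _; exact: gL.
have := @birkhoff_distortion _ _ _ _ _ _ C theta g 0 n.+1 x p C0 th0 th1 gC.
rewrite addn0 expr0 mulr1 => /(_ xp); rewrite ler_norml => /andP[_].
rewrite -/m0 -/g; lra.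
Qed.

(** The Lax-Oleinik (Mañé potential) supremum over all finite pasts of [y],
    the empty one included. *)
Definition subaction f y : R :=
  sup [set birkhoff f nx.1 nx.2 | nx in [set nx | iter nx.1 shift nx.2 = y]].

Section subaction_theory.
Context (f : X -> R) (D : R).
Hypothesis fD : forall n x, birkhoff f n x <= D.

Lemma birkhoff_subaction n x : birkhoff f n x <= subaction f (iter n shift x).
Proof.
by apply: ub_le_sup; [exists D => _ [nx _ <-]|exists (n, x)].
Qed.

Lemma subaction_le y c :
    (forall n x, iter n shift x = y -> birkhoff f n x <= c) ->
  subaction f y <= c.
Proof.
move=> yc; apply: ge_sup; first by exists (birkhoff f 0 y), (0%N, y).
by move=> _ [[n x] /= xy <-]; exact: yc.
Qed.

Lemma subaction_ge0 y : 0 <= subaction f y.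
Proof. by have := birkhoff_subaction 0 y; rewrite /birkhoff big_ord0. Qed.

Lemma subaction_shift x : subaction f x + f x <= subaction f (shift x).
Proof.
rewrite -lerBrDr; apply: subaction_le => n u ux.
have := birkhoff_subaction n.+1 u; rewrite birkhoffSr /= ux; lra.
Qed.

(** For [m = 0] the points share no symbol and the oscillation is at most [D],
    since [0 <= subaction f <= D]; for [m > 0] every finite past of one point is
    spliced to the other one. *)
Lemma subaction_geometric_variation C theta :
    0 <= C -> 0 < theta -> theta < 1 -> geometric_variation C theta f ->
  geometric_variation (D + C / (1 - theta)) theta (subaction f).
Proof.
move=> C0 th0 th1 fC m x y xy.
have d0 : 0 < 1 - theta by lra.
have K0 : 0 <= C / (1 - theta) by rewrite divr_ge0// ltW.
have D0 : 0 <= D by have := fD 0 point; rewrite /birkhoff big_ord0.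
suff half u v : agree m u v ->
    subaction f u <= subaction f v + (D + C / (1 - theta)) * theta ^+ m.
  have := half x y xy; have := half y x (agree_sym xy).
  rewrite ler_norml; lra.
move=> uv; apply: subaction_le => n w wu.
case: m {x y xy} uv => [|m] uv.
  by have := subaction_ge0 v; have := fD n w; rewrite expr0; lra.
have [w' w'v ww'] := splice wu uv.
have := birkhoff_distortion C0 th0 th1 fC ww'.
rewrite ler_norml => /andP[_]; have := birkhoff_subaction n w'; rewrite w'v.
have : 0 <= D * theta ^+ m.+1 by rewrite mulr_ge0// exprn_ge0// ltW.
rewrite mulrDl; lra.
Qed.

End subaction_theory.
End subaction.

Theorem mainTheorem7 (R : realType) (T : finType) (M : rel T) (lam : R)
    (hne : admissible M !=set0) (hlam : 1 < lam)
    (hmix : topologically_mixing hne hlam)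
    (A : sft hne hlam -> R) (hA : holder A) :
  (exists V : sft hne hlam -> R, holder V /\
    forall mu : probability (sft hne hlam) R, maximizing A mu ->
    forall x, msupport mu x ->
      A x = V x - V (sft_shift x) + max_integral A) /\
  (forall mu nu : probability (sft hne hlam) R, maximizing A mu ->
    shift_invariant nu -> nu (msupport mu) = 1%E -> maximizing A nu).
Proof.
have [alpha [C [a0 a1 C0 AC]]] := (holderP A).1 hA.
have th0 := holder_ratio_gt0 (hlam := hlam) alpha.
have th1 := holder_ratio_lt1 (hlam := hlam) a0.
have [D D0 AD] := birkhoff_mean_zero_le hmix C0 th0 th1 AC.
set m0 := max_integral A; pose g x := A x - m0.
have {}AD n x : birkhoff g n x <= D := AD n x.
have gC : geometric_variation C (holder_ratio lam alpha) g.
  exact: geometric_variation_subr.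
have WC := subaction_geometric_variation AD C0 th0 th1 gC.
pose V x := - subaction g x.
have VC : geometric_variation (D + C / (1 - holder_ratio lam alpha))
    (holder_ratio lam alpha) V.
  by move=> n x y /WC; rewrite /V -opprD normrN.
have cA := geometric_variation_continuous th0 th1 AC.
have cV := geometric_variation_continuous th0 th1 VC.
have bA := geometric_variation_bounded AC.
have bV := geometric_variation_bounded VC.
pose h x := V x - V (sft_shift x) + m0.
have ch : continuous h.
  move=> x; apply: (@cvgD _ _ _ (nbhs x) (nbhs_filter x)); last exact: cvg_cst.
  by apply: cvgB; [exact: cV|exact: (continuous_comp_shift cV)].
(* The sub-action inequality, rewritten for [V]. *)
have Ah x : A x <= h x.
  have := subaction_shift AD x; have -> : g x = A x - m0 by [].
  rewrite /h /V; lra.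
have key mu : maximizing A mu -> forall x, msupport mu x -> A x = h x.
  move=> [inv Am0] x xs; apply/esym/eqP; rewrite -subr_eq0; apply/eqP.
  have [LA bA'] := bA; have [LV bV'] := bV.
  have bh : exists K : R, forall x, `|h x| <= K.
    exists (LV + LV + `|m0|) => u.
    rewrite (le_trans (ler_normD _ _))// lerD2r.
    by rewrite (le_trans (ler_normB _ _))// lerD.
  apply: (@support_vanish _ _ _ _ _ _ mu (fun x => h x - A x)) xs.
  - move=> u.
    exact: (@cvgB _ _ _ (nbhs u) (nbhs_filter u) _ _ _ _ (ch u) (cA u)).
  - by move=> u; rewrite subr_ge0.
  - have [Lh bh'] := bh; exists (Lh + LA) => u.
    by rewrite (le_trans (ler_normB _ _))// lerD.
  rewrite RintegralB//; [|exact: bounded_integrable..].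
  by rewrite Am0 Rintegral_coboundary// subrr.
split.
  exists V; split; last exact: key.
  apply/holderP; exists alpha, (D + C / (1 - holder_ratio lam alpha)).
  split => //.
  by rewrite addr_ge0// divr_ge0// subr_ge0 ltW.
move=> mu nu /key muA inv nu1; split => //.
by rewrite (Rintegral_support cA ch nu1 muA) Rintegral_coboundary.
Qed.
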